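(* Let $T$ be a tree with at least one edge and let $G_T$ be a signed graph obtained from $T$ by replacing each of its end vertices (the vertices of degree 1) with an unbalanced circuit. Let $v_1,v_2,\dots,v_p$ be the vertices of $T$ of degree at least 3 and let $d_1,d_2,\dots,d_p$ be their degrees in $T$, respectively. Then $$F_0(G_T,x)=(x-1)\prod_{i=1}^{p}\left(x^{d_i-2}-\binom{d_i-1}{1}x^{d_i-3}+\cdots+(-1)^{d_i-2}\binom{d_i-1}{d_i-2}\right),$$ i.e. the $i$-th factor is $\sum_{j=0}^{d_i-2}(-1)^j\binom{d_i-1}{j}x^{d_i-2-j}$.
   Context: Graphs are finite and may contain parallel edges and loops. A signed graph is a graph in which each edge is positive or negative. A circuit is a connected 2-regular graph (a loop is a circuit of length 1); it is unbalanced if it has an odd number of negative edges. Replacing an end vertex $u$ of $T$ with an unbalanced circuit means: $u$ is replaced by an unbalanced circuit $C_u$ (the circuits for different end vertices are vertex-disjoint from each other and from the rest of the graph), and the unique edge of $T$ incident with $u$ is attached instead to one vertex of $C_u$. Orientation and flows: a positive edge is oriented in the usual way. A negative edge consists of two half-edges, one at each end, and is oriented either extroverted (incoming at both ends) or introverted (outgoing at both ends). Given a fixed orientation of a signed graph $G$, a $\Gamma$-flow ($\Gamma$ an additive Abelian group) is a map $\mathbf f:E(G)\to\Gamma$ such that at every vertex $v$ the sum of the values of $\mathbf f$ over the edges and half-edges incoming at $v$ equals the sum over those outgoing at $v$ (a loop contributes at $v$ through both of its ends). It is nowhere-zero if $\mathbf f(e)\neq0$ for all $e$. The number of nowhere-zero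 $\Gamma$-flows does not depend on the orientation. $F_0(G,x)$ is the polynomial (known to exist) such that, for every Abelian group $\Gamma$ of odd order $k$, the number of nowhere-zero $\Gamma$-flows in $G$ equals $F_0(G,k)$. *)

(* Defs.v *)
From mathcomp Require Import all_boot all_algebra.

Set Implicit Arguments.
Unset Strict Implicit.
Unset Printing Implicit Defensive.

Import GRing.Theory.
Local Open Scope ring_scope.

(* Parallel edges and loops are allowed.  An edge [e] consists of the two
   half-edges [(e, false)] and [(e, true)], and [ends e b] is the vertex at
   which [(e, b)] sits; the order of the two ends carries no meaning. *)
Record mgraph := MGraph {
  vert :> finType;
  edge : finType;
  ends : edge -> bool -> vert
}.

(* A loop counts twice. *)
Definition deg (G : mgraph) (v : G) : nat :=
  #|[set h : edge G * bool | ends h.1 h.2 == v]|.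

Definition adj (G : mgraph) : rel G :=
  [rel u v | [exists e : edge G, exists b : bool,
                (ends e b == u) && (ends e (~~ b) == v)]].

Definition connected_graph (G : mgraph) : Prop :=
  (0 < #|vert G|)%N /\ forall u v : G, connect (@adj G) u v.

Definition circuit (G : mgraph) : Prop :=
  connected_graph G /\ forall v : G, deg v = 2.

(* [H] is isomorphic to a subgraph of [G]; the bit [c] says whether the two
   ends of [e] are listed in the same order in [H] and in [G]. *)
Definition is_subgraph (H G : mgraph) : Prop :=
  exists (f : H -> G) (g : edge H -> edge G),
    [/\ injective f, injective g &
        forall e : edge H, exists c : bool,
          forall b : bool, ends (g e) b = f (ends e (b (+) c))].

Definition tree (T : mgraph) : Prop :=
  connected_graph T /\ forall C : mgraph, circuit C -> ~ is_subgraph C T.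

Record sgraph := SGraph {
  sgraph_graph :> mgraph;
  negative : edge sgraph_graph -> bool
}.

Definition unbalanced_circuit (C : sgraph) : Prop :=
  circuit C /\ odd #|[set e : edge C | negative e]|.

(* [o e b] is true when the half-edge [(e, b)] is incoming at [ends e b]:
   a positive edge has one incoming and one outgoing half-edge, the two
   half-edges of a negative edge are both incoming or both outgoing. *)
Definition orientation (G : sgraph) (o : edge G -> bool -> bool) : Prop :=
  forall e : edge G, (o e false == o e true) = negative e.

Definition is_flow (G : sgraph) (o : edge G -> bool -> bool)
    (Gamma : finZmodType) (f : {ffun edge G -> Gamma}) : bool :=
  [forall v : G,
     \sum_(h : edge G * bool | (ends h.1 h.2 == v) && o h.1 h.2) f h.1 ==
     \sum_(h : edge G * bool | (ends h.1 h.2 == v) && ~~ o h.1 h.2) f h.1].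

Definition nz_flows (G : sgraph) (o : edge G -> bool -> bool)
    (Gamma : finZmodType) : {set {ffun edge G -> Gamma}} :=
  [set f | is_flow o f & [forall e, f e != 0]].

(* [p] is the polynomial F_0(G, x).  It is quantified over all orientations
   because the number of nowhere-zero flows does not depend on them; at most
   one [p] qualifies, there being infinitely many odd orders. *)
Definition is_F0 (G : sgraph) (p : {poly rat}) : Prop :=
  forall o : edge G -> bool -> bool, orientation o ->
  forall Gamma : finZmodType, odd #|Gamma| ->
    p.[#|Gamma|%:R] = #|nz_flows o Gamma|%:R.

Definition end_vertex (T : mgraph) : finType := {u : T | deg u == 1}.
Definition inner_vertex (T : mgraph) : finType := {v : T | deg v != 1}.

(* The signed graph obtained from [T] by giving its edges the signs [sgn]
   (true for negative), replacing each end vertex [u] with [C u] and attaching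
   the edge of [T] at [u] to the vertex [a u] of [C u]. *)
Section ReplaceEnds.
Variables (T : mgraph) (sgn : edge T -> bool).
Variables (C : end_vertex T -> sgraph) (a : forall u, C u).

Definition repl_vert : finType :=
  (inner_vertex T + {u : end_vertex T & vert (C u)})%type.

Definition repl_edge : finType :=
  (edge T + {u : end_vertex T & edge (C u)})%type.

Definition repl_at (v : T) : repl_vert :=
  match boolP (deg v == 1) with
  | AltTrue v_end => inr (existT _ (exist _ v v_end) (a (exist _ v v_end)))
  | AltFalse v_inner => inl (exist _ v v_inner)
  end.

Definition repl_ends (e : repl_edge) (b : bool) : repl_vert :=
  match e with
  | inl e => repl_at (ends e b)
  | inr (existT u e) => inr (existT _ u (ends e b))
  end.

Definition repl_negative (e : repl_edge) : bool :=
  match e with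
  | inl e => sgn e
  | inr (existT u e) => negative e
  end.

Definition replace_ends : sgraph :=
  @SGraph (MGraph repl_ends) repl_negative.

End ReplaceEnds.

(* Main.v *)
(* Since the order k of Gamma is odd, each unbalanced circuit admits exactly one
   flow with a prescribed inflow g at the vertex where the tree is attached: its
   values are c and -c for a single c, and c = 0 only if g = 0.  So nowhere-zero
   flows of G_T correspond to nowhere-zero functions on the edges of T that are
   conserved at the vertices of degree other than 1.  These are counted by
   growing a subtree of T one vertex at a time, starting from a single edge
   (k - 1 choices): a new vertex of degree d >= 2 meets exactly one edge whose
   value is already chosen, and the other d - 1 values must be nonzero with a
   prescribed nonzero signed sum, which leaves
   ((k - 1)^(d - 1) - (-1)^(d - 1)) / k choices. *)
Require Import Defs.
From mathcomp Require Import all_boot all_algebra fingroup cyclic ring.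

Set Implicit Arguments.
Unset Strict Implicit.
Unset Printing Implicit Defensive.

Import GRing.Theory.
Local Open Scope ring_scope.

(** * Net inflow at a vertex, and counting by half-edges *)

Definition signed (Gamma : zmodType) (b : bool) (x : Gamma) : Gamma :=
  if b then x else - x.

(** Incoming minus outgoing as one signed sum: conservation becomes a linear condition, so flows can
    be subtracted from one another. *)
Definition net (G : mgraph) (Gamma : zmodType) (o : edge G -> bool -> bool)
    (f : edge G -> Gamma) (v : G) : Gamma :=
  \sum_(h : edge G * bool | ends h.1 h.2 == v) signed (o h.1 h.2) (f h.1).

Lemma signed_eq0 (Gamma : zmodType) b (x : Gamma) : (signed b x == 0) = (x == 0).
Proof. by case: b; rewrite /signed ?oppr_eq0. Qed.

Lemma signedB (Gamma : zmodType) b (x y : Gamma) :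
  signed b (x - y) = signed b x - signed b y.
Proof. by case: b; rewrite /signed // opprB opprK addrC. Qed.

Lemma netB (G : mgraph) (Gamma : zmodType) (o : edge G -> bool -> bool)
    (f g : edge G -> Gamma) v :
  net o (fun e => f e - g e) v = net o f v - net o g v.
Proof. by rewrite /net -sumrB; apply: eq_bigr => h _; rewrite signedB. Qed.

Lemma eq_net (G : mgraph) (Gamma : zmodType) (o : edge G -> bool -> bool)
    (f g : edge G -> Gamma) v :
  (forall h : edge G * bool, ends h.1 h.2 == v -> f h.1 = g h.1) ->
  net o f v = net o g v.
Proof. by move=> fg; apply: eq_bigr => h /fg ->. Qed.

Lemma is_flowE (G : sgraph) o (Gamma : finZmodType) (f : {ffun edge G -> Gamma}) :
  is_flow o f = [forall v, net o f v == 0].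
Proof.
apply: eq_forallb => v; rewrite /net [X in _ = (X == 0)](bigID (fun h => o h.1 h.2)) /=.
rewrite [X in _ = (X + _ == 0)](eq_bigr (fun h => f h.1)); last first.
  by move=> h /andP[_ ->].
rewrite [X in _ = (_ + X == 0)](eq_bigr (fun h => - f h.1)); last first.
  by move=> h /andP[_ /negbTE->].
by rewrite sumrN subr_eq0.
Qed.

(** If [x + x = 0], every odd multiple of [x] is [x] itself, while the multiple by the group order
    vanishes by Lagrange. *)
Lemma odd_order_opp_eq (Gamma : finZmodType) (x : Gamma) :
  odd #|Gamma| -> x = - x -> x = 0.
Proof.
move=> odd_k x_opp; have := expg_cardG (in_setT x).
rewrite cardsT FinRing.zmodXgE -[in x *+ _](odd_double_half #|Gamma|) odd_k.
rewrite -mul2n mulrnDr mulrnA mulr2n {2}x_opp addNr mul0rn addr0; exact.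
Qed.

Lemma sum_half_edges (G : mgraph) (F : edge G * bool -> nat) :
  (\sum_h F h = \sum_e (F (e, false) + F (e, true)))%N.
Proof.
rewrite (eq_bigr (fun h => F (h.1, h.2))) => [|[] //].
rewrite -(pair_big xpredT xpredT (fun e b => F (e, b))) /=.
by apply: eq_bigr => e _; rewrite big_bool addnC.
Qed.

Lemma sum_half_edges_at (G : mgraph) (F : edge G * bool -> nat) :
  (\sum_h F h = \sum_(v : G) \sum_(h | ends h.1 h.2 == v) F h)%N.
Proof. by rewrite (partition_big (fun h => ends h.1 h.2) xpredT). Qed.

Lemma deg_eq2 (G : mgraph) (v : G) : deg v = 2%N ->
  exists h1 h2, h1 != h2 /\ forall h, (ends h.1 h.2 == v) = (h == h1) || (h == h2).
Proof.
rewrite /deg => /eqP/cards2P [h1 [h2 [ne_h Ev]]]; exists h1, h2; split=> // h.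
by have := in_set2 h h1 h2; rewrite -Ev inE.
Qed.

Lemma big_two (R : Type) (idx : R) (op : Monoid.com_law idx) (I : finType)
    (P : pred I) (i j : I) (F : I -> R) :
  i != j -> (forall k, P k = (k == i) || (k == j)) ->
  \big[op/idx]_(k | P k) F k = op (F i) (F j).
Proof.
move=> ne_ij Pk; rewrite (bigD1 i) ?Pk ?eqxx //= (big_pred1 j) // => k.
by rewrite Pk /=; case: (eqVneq k i) => [->|] /=; rewrite ?andbT // (negbTE ne_ij).
Qed.

(** * Flows on unbalanced circuits *)

Section Circuit.
Variables (C : sgraph) (C_circuit : circuit C).

(* By the handshake lemma, E0 uses an even number of half-edges at a. *)
Lemma circuit_edges_all_or_none (a : C) (E0 : {set edge C}) :
  (forall v, v != a -> forall h h' : edge C * bool, ends h.1 h.2 == v ->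
     ends h'.1 h'.2 == v -> (h.1 \in E0) = (h'.1 \in E0)) ->
  forall e e', (e \in E0) = (e' \in E0).
Proof.
have [[_ conn] deg2] := C_circuit; move=> E0_off.
pose n v : nat := (\sum_(h : edge C * bool | ends h.1 h.2 == v) (h.1 \in E0))%N.
have even_sum : ~~ odd (\sum_v n v)%N.
  rewrite -sum_half_edges_at sum_half_edges /=.
  by apply: (big_ind (fun m => ~~ odd m)) => // [x y|e _];
    rewrite oddD ?addbb // => /negbTE-> /negbTE->.
have even_off v : v != a -> ~~ odd (n v).
  move=> va; have [h1 [h2 [ne_h Ev]]] := deg_eq2 (deg2 v).
  rewrite /n (big_two _ _ ne_h Ev) /= (E0_off v va h1 h2) ?Ev ?eqxx ?orbT //.
  by rewrite oddD addbb.
have even_a : ~~ odd (n a).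
  move: even_sum; rewrite (bigD1 a) //= oddD.
  suff /negbTE->: ~~ odd (\sum_(v | v != a) n v)%N by rewrite addbF.
  by apply: (big_ind (fun m => ~~ odd m)) => // x y; rewrite oddD => /negbTE-> /negbTE->.
have E0_at v (h h' : edge C * bool) : ends h.1 h.2 == v ->
    ends h'.1 h'.2 == v -> (h.1 \in E0) = (h'.1 \in E0).
  have [->|/E0_off] := eqVneq v a; last exact.
  have [h1 [h2 [ne_h Ev]]] := deg_eq2 (deg2 a).
  move: even_a; rewrite /n (big_two _ _ ne_h Ev) /= !Ev oddD !oddb => eq12.
  have {}eq12 : (h1.1 \in E0) = (h2.1 \in E0).
    by case: (h1.1 \in E0) eq12; case: (h2.1 \in E0).
  by case/orP=> /eqP->; case/orP=> /eqP->; rewrite ?eq12.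
(* Membership in [V0], the set of vertices meeting [E0], is invariant under adjacency, hence
   constant by connectedness. *)
pose V0 := [pred v | [exists h : edge C * bool, (ends h.1 h.2 == v) && (h.1 \in E0)]].
have V0P e b : (ends e b \in V0) = (e \in E0).
  apply/existsP/idP => [[h /andP[hv]]|eE0]; last by exists (e, b); rewrite eqxx.
  by rewrite (E0_at (ends e b) h (e, b)).
have closedV : closed (@adj C) V0.
  by move=> u v /existsP[e /existsP[b /andP[/eqP<- /eqP<-]]]; rewrite !V0P.
move=> e e'; rewrite -(V0P e true) -(V0P e' true).
exact: closed_connect closedV _ _ (conn _ _).
Qed.

Section Flow.
Variables (Gamma : finZmodType) (odd_Gamma : odd #|Gamma|).
Variables (o : edge C -> bool -> bool) (o_orient : orientation o).
Implicit Type f : edge C -> Gamma.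

(** Where the net is zero, the two signed values are opposite, so the set of edges with value [f e]
    or [- f e] uses both half-edges or neither. Parity takes care of the exceptional vertex [a]. *)
Lemma circuit_flow_const f (a : C) : (forall v, v != a -> net o f v = 0) ->
  forall e e', (f e' == f e) || (f e' == - f e).
Proof.
move=> net0 e e'; pose E0 := [set d | (f d == f e) || (f d == - f e)].
have E0_signed (h : edge C * bool) : (h.1 \in E0) =
    ((signed (o h.1 h.2) (f h.1) == f e) || (signed (o h.1 h.2) (f h.1) == - f e)).
  rewrite inE /signed; case: (o _ _) => //.
  by rewrite eqr_oppLR (inj_eq oppr_inj) orbC.
suff: e' \in E0 by rewrite inE.
rewrite (@circuit_edges_all_or_none a E0 _ e' e) ?inE ?eqxx // => v /net0.
have [h1 [h2 [ne_h Ev]]] := deg_eq2 (C_circuit.2 v).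
rewrite /net (big_two _ _ ne_h Ev) => /eqP; rewrite addr_eq0 => /eqP eq12.
have {}eq12 : (h1.1 \in E0) = (h2.1 \in E0).
  by rewrite !E0_signed eq12 eqr_oppLR (inj_eq oppr_inj) orbC.
by move=> h h'; rewrite !Ev; case/orP=> /eqP->; case/orP=> /eqP->; rewrite ?eq12.
Qed.

(** Twice either side counts the half-edges, since all degrees are 2. *)
Lemma circuit_card : #|edge C| = #|C|.
Proof.
apply: double_inj; rewrite -!muln2 -!sum_nat_const.
have := @sum_half_edges_at C (fun=> 1%N); rewrite sum_half_edges => ->.
apply: eq_bigr => v _; rewrite sum1_card -[RHS](C_circuit.2 v) /deg.
by apply: eq_card => h; rewrite !inE.
Qed.

Hypothesis C_odd : odd #|[set e : edge C | negative e]|.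

(* Otherwise f takes values c and -c only, with c != -c.  Exactly one of the
   two half-edges at each vertex carries the signed value c, so |V| = |E|
   half-edges do; each positive edge has one of them, each negative edge has
   none or two, hence the number of negative edges is even. *)
Lemma unbalanced_flow0 f : (forall v, net o f v = 0) -> forall e, f e = 0.
Proof.
move=> net0 e0; apply/eqP/negPn/negP => nz; set c := f e0 in nz.
have c_opp : c != - c by apply: contraNneq nz => /(odd_order_opp_eq odd_Gamma) ->.
have fc e : (f e == c) || (f e == - c).
  exact: (@circuit_flow_const f (ends e0 true)).
pose t (h : edge C * bool) := signed (o h.1 h.2) (f h.1) == c.
have sum_t : (\sum_h t h = #|C|)%N.
  rewrite sum_half_edges_at -sum1_card; apply: eq_bigr => v _.
  have [h1 [h2 [ne_h Ev]]] := deg_eq2 (C_circuit.2 v).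
  have := net0 v; rewrite /net !(big_two _ _ ne_h Ev) /= => /eqP.
  rewrite addr_eq0 /t => /eqP->; have := fc h2.1; rewrite /signed.
  case: (o _ _); case/orP=> /eqP->; rewrite ?opprK ?eqxx;
    by rewrite ?(negbTE c_opp) // eq_sym (negbTE c_opp).
have t_edge e : ((t (e, false) + t (e, true)) + negative e
    = 1 + (negative e && t (e, false)).*2)%N.
  have := o_orient e; rewrite /t /signed /=; have := fc e.
  case: (negative e); case: (o e false); case: (o e true) => //= /orP[]/eqP-> _;
    by rewrite ?opprK ?eqxx ?(negbTE c_opp) // eq_sym (negbTE c_opp).
move: C_odd; rewrite -sum1dep_card big_mkcond /=.
rewrite (eq_bigr (fun e => negative e : nat)) => [|e _]; last by case: negative.
suff ->: (\sum_(e : edge C) negative e =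
    (\sum_(e : edge C) (negative e && t (e, false))).*2)%N.
  by rewrite odd_double.
apply/eqP; rewrite -(eqn_add2l #|C|) -{1}sum_t sum_half_edges -big_split /=.
rewrite (eq_bigr _ (fun e _ => t_edge e)) big_split /= sum1_card circuit_card.
by rewrite -!muln2 big_distrl /=; under eq_bigr do rewrite -muln2.
Qed.

Lemma unbalanced_net_inj (f g : edge C -> Gamma) :
  (forall v, net o f v = net o g v) -> f =1 g.
Proof.
move=> fg e; apply/eqP; rewrite -subr_eq0; apply/eqP.
by apply: (@unbalanced_flow0 (fun e => f e - g e)) => v; rewrite netB fg subrr.
Qed.

(** The map from [f] to its nets is injective, and its source and target are equally large because a
    circuit has as many edges as vertices. *)
Lemma unbalanced_net_onto (b : C -> Gamma) :
  exists f : {ffun edge C -> Gamma}, forall v, net o f v = b v.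
Proof.
pose phi (f : {ffun edge C -> Gamma}) := [ffun v : C => net o f v].
have phi_inj : injective phi.
  move=> f g /ffunP fg; apply/ffunP; apply: unbalanced_net_inj => v.
  by have := fg v; rewrite !ffunE.
have := inj_card_onto phi_inj _ [ffun v => b v]; rewrite !card_ffun circuit_card.
case/(_ (leqnn _))/codomP=> f fb; exists f => v.
by have /ffunP/(_ v) := fb; rewrite !ffunE.
Qed.

(** All values agree up to sign, so a single zero would make [f] vanish everywhere, and with it the
    net at [a]. *)
Lemma unbalanced_nowhere_zero f (a : C) : (forall v, v != a -> net o f v = 0) ->
  net o f a != 0 -> forall e, f e != 0.
Proof.
move=> net0 nz e; apply: contraNneq nz => fe0.
rewrite /net big1 // => h _; apply/eqP; rewrite signed_eq0.
by have := circuit_flow_const net0 e h.1; rewrite fe0 oppr0 orbb.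
Qed.

End Flow.
End Circuit.

(** * Cycles, and bridges in trees *)

Lemma adj_sym (G : mgraph) : symmetric (@adj G).
Proof.
by move=> u v; apply/existsP/existsP=> -[e /existsP[b /andP[eu ev]]];
  exists e; apply/existsP; exists (~~ b); rewrite negbK eu ev.
Qed.

(** Edge [i] runs from [i] to its cyclic successor; [n = 0] gives a loop and [n = 1] two parallel
    edges, so all circuit lengths are covered. *)
Definition cycle_graph (n : nat) : mgraph :=
  @MGraph 'I_n.+1 'I_n.+1 (fun i b => if b then ordS i else i).

Lemma cycle_graph_circuit n : circuit (cycle_graph n).
Proof.
split; first split=> [|u v]; first by rewrite card_ord.
  have from0 (w : cycle_graph n) : connect (@adj (cycle_graph n)) ord0 w.
    case: w => m; elim: m => [|m IHm] lt_m.
      by rewrite (_ : Ordinal lt_m = ord0) ?connect0 //; apply: val_inj.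
    apply: connect_trans (IHm (ltnW lt_m)) (connect1 _).
    apply/existsP; exists (Ordinal (ltnW lt_m)); apply/existsP; exists false.
    by rewrite /= eqxx; apply/eqP/val_inj; rewrite /= modn_small.
  by apply: connect_trans (from0 v); rewrite sym_connect_sym //; apply: adj_sym.
move=> v; rewrite /deg (_ : [set h | _] = [set (v : 'I_n.+1, false); (ord_pred v, true)]).
  by rewrite cards2 xpair_eqE andbF.
apply/setP=> -[i [|]]; rewrite !inE !xpair_eqE /= ?andbF ?andbT ?orbF //.
by rewrite -{1}[v]ord_predK (inj_eq (@ordS_inj _)).
Qed.

(** Only [e] itself is deleted: an edge parallel to [e] still joins its ends. *)
Definition adj_avoiding (G : mgraph) (e : edge G) : rel G :=
  [rel u v | [exists d : edge G, exists b : bool,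
                [&& d != e, ends d b == u & ends d (~~ b) == v]]].

Lemma adj_avoiding_sym (G : mgraph) (e : edge G) : symmetric (adj_avoiding e).
Proof.
by move=> u v; apply/existsP/existsP=> -[d /existsP[b /and3P[de du dv]]];
  exists d; apply/existsP; exists (~~ b); rewrite negbK de du dv.
Qed.

(* A path avoiding e between the ends of e closes up with e to a cycle. *)
Lemma tree_bridge (T : mgraph) (e : edge T) : tree T ->
  ~~ connect (adj_avoiding e) (ends e false) (ends e true).
Proof.
case=> _ acyclic; apply/negP=> /connectP[p0 p0_path].
set x := ends e false; case/shortenP: p0_path => p p_path p_uniq _ p_last {p0}.
pose n := size p; pose q := nth x (x :: p).
pose link i d := (d != e) && [exists b, (ends d b == q i) && (ends d (~~ b) == q i.+1)].
have q_inj i j : (i <= n)%N -> (j <= n)%N -> q i = q j -> i = j.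
  by move=> lei lej /eqP; rewrite nth_uniq // => /eqP.
have linkP i : (i < n)%N -> exists d, link i d.
  move=> lti; have /(pathP x)/(_ i lti) := p_path.
  case/existsP=> d /existsP[b /and3P[de di dj]].
  by exists d; rewrite /link de; apply/existsP; exists b; rewrite di dj.
(* Index [n] receives the closing edge [e]. Below [n] the default is never reached, since [linkP]
   supplies an edge. *)
pose g (i : 'I_n.+1) := if (i < n)%N then odflt e [pick d | link i d] else e.
have g_link (i : 'I_n.+1) : (i < n)%N -> link i (g i).
  rewrite /g => lti; rewrite lti; case: pickP => //= no.
  by have [d] := linkP i lti; rewrite no.
have g_max (i : 'I_n.+1) : (n <= i)%N -> g i = e by rewrite /g ltnNge => ->.
apply: (acyclic (cycle_graph n) (cycle_graph_circuit n)).
exists (fun i : 'I_n.+1 => q i), g; split=> [i j|i j eq_g|i].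
- by move=> /q_inj eq_ij; apply/val_inj/eq_ij; rewrite -ltnS ltn_ord.
- apply: val_inj => /=; have := ltn_ord i; have := ltn_ord j; rewrite !ltnS.
  move=> lej lei; case: (ltnP i n) (g_link i) (g_max i) => [lti /(_ isT)|gei _ /(_ isT)];
    case: (ltnP j n) (g_link j) (g_max j) => [ltj /(_ isT)|gej _ /(_ isT)].
  + rewrite -eq_g => /andP[_ /existsP[b' /andP[/eqP j1 /eqP j2]]] _.
    case/andP=> _ /existsP[b /andP[/eqP i1 /eqP i2]] _.
    case: (eqVneq b b') => [eb|]; first by apply: q_inj; rewrite // -i1 eb j1.
    (* An edge used at [i] and [j] in opposite directions would force both [i = j + 1] and
       [j = i + 1]. *)
    move=> ne; have eb : b' = ~~ b by case: b b' ne {i1 i2 j1 j2} => -[].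
    have ij : i = j.+1 :> nat by apply: q_inj; rewrite // -i1 -j2 eb negbK.
    have ji : i.+1 = j by apply: q_inj; rewrite // -i2 -j1 eb.
    by have : (j < i.+1)%N; [rewrite ij ltnS leqnSn | rewrite ji ltnn].
  + by rewrite -eq_g => -> /andP[]; rewrite eqxx.
  + by move=> /andP[ne _] _ gi; rewrite -eq_g gi eqxx in ne.
  + by move=> _ _; apply/eqP; rewrite eqn_leq (leq_trans lei) ?(leq_trans lej).
case: (ltnP i n) (g_link i) (g_max i) => [lti /(_ isT) + _|gei _ /(_ isT) ->].
  case/andP=> _ /existsP[b /andP[/eqP i1 /eqP i2]]; exists b => b'.
  case: (eqVneq b' b) => [->|]; first by rewrite addbb.
  move=> ne; have ->: b' = ~~ b by case: b b' ne {i1 i2} => -[].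
  by rewrite i2 addNb addbb /= modn_small.
have i_n : val i = n by apply/eqP; rewrite eqn_leq gei -ltnS ltn_ord.
(* The closing edge of the cycle runs from the last vertex back to [x], against the order in which
   the ends of [e] are listed. *)
exists true => -[|] /=; rewrite i_n ?modnn // p_last.
by rewrite /q (last_nth x).
Qed.

(** * Functions with a prescribed support *)

Section Support.
Variables (E : finType) (Gamma : finZmodType).
Implicit Types (A B : {set E}) (f g : {ffun E -> Gamma}) (F : {ffun E -> Gamma} -> nat).

(** A nowhere-zero assignment on a set [A] of edges is encoded as a total function with support
    exactly [A], so that partial assignments can be added. *)
Definition supp f : {set E} := [set e | f e != 0].

Lemma suppN A f e : supp f = A -> (f e == 0) = (e \notin A).
Proof. by move=> <-; rewrite inE negbK. Qed.

Definition restr A f : {ffun E -> Gamma} := [ffun e => if e \in A then f e else 0].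

(** A function supported exactly on a disjoint union splits uniquely into its restrictions to the
    two pieces. *)
Lemma big_supp_setU A B F : [disjoint A & B] ->
  (\sum_(f | supp f == A :|: B) F f =
   \sum_(f | supp f == A) \sum_(g | supp g == B) F (f + g)%R)%N.
Proof.
move=> /pred0P disj; rewrite pair_big /=.
have disjAB e : (e \in A) && (e \in B) = false by exact: (disj e).
have restr_sum f : supp f = A :|: B -> restr A f + restr B f = f.
  move=> fAB; apply/ffunP=> e; rewrite !ffunE.
  have := suppN e fAB; have := disjAB e; rewrite inE.
  case: (e \in A); case: (e \in B) => //= _; rewrite ?addr0 ?add0r //.
  by move/eqP->.
rewrite (reindex_onto
    (fun p : {ffun E -> Gamma} * {ffun E -> Gamma} => p.1 + p.2 : {ffun E -> Gamma})
    (fun f => (restr A f, restr B f))) /=; last by move=> f /eqP/restr_sum.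
apply: eq_bigl => -[f g] /=; rewrite xpair_eqE; apply/idP/idP.
  case/and3P=> /eqP fgAB /eqP fA /eqP gB.
  apply/andP; split; [rewrite -fA|rewrite -gB]; apply/eqP/setP=> e; rewrite inE ffunE;
    have := suppN e fgAB; rewrite inE.
  - by case: (e \in A); rewrite ?eqxx // => ->.
  - by case: (e \in B); rewrite ?eqxx // orbT => ->.
case/andP=> /eqP fA /eqP gB; have f0 e := suppN e fA; have g0 e := suppN e gB.
apply/and3P; split; apply/eqP.
- apply/setP=> e; rewrite !inE ffunE; have := disjAB e; have := f0 e; have := g0 e.
  case: (e \in A) => /=; case: (e \in B) => //= gz fz _.
  + by rewrite (eqP gz) addr0 fz.
  + by rewrite (eqP fz) add0r gz.
  + by rewrite (eqP gz) (eqP fz) addr0 eqxx.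
- apply/ffunP=> e; rewrite !ffunE; have := disjAB e; have := f0 e; have := g0 e.
  case: (e \in A) => /=; case: (e \in B) => //= /eqP gz /eqP fz _;
  by rewrite ?gz ?fz ?addr0.
- apply/ffunP=> e; rewrite !ffunE; have := disjAB e; have := f0 e; have := g0 e.
  case: (e \in A) => /=; case: (e \in B) => //= /eqP gz /eqP fz _;
  by rewrite ?gz ?fz ?add0r.
Qed.

Lemma big_supp1 e F : (\sum_(f | supp f == [set e]) F f =
  \sum_(x : Gamma | x != 0%R) F [ffun d => if d == e then x else 0%R])%N.
Proof.
rewrite (reindex_onto (fun x : Gamma => [ffun d => if d == e then x else 0])
                      (fun f => f e)) /=.
  apply: eq_bigl => x; rewrite ffunE !eqxx andbT; apply/eqP/idP => [/setP/(_ e)|x0].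
    by rewrite !inE ffunE !eqxx.
  by apply/setP=> d; rewrite !inE ffunE; case: (d == e); rewrite ?x0 ?eqxx.
move=> f /eqP fe; apply/ffunP=> d; rewrite ffunE; case: eqP => [->//|/eqP de].
by apply/esym/eqP; rewrite (suppN d fe) inE.
Qed.

Lemma big_supp0 F : (\sum_(f | supp f == set0) F f = F 0%R)%N.
Proof.
apply: big_pred1 => f /=; apply/eqP/eqP => [f0|->].
  by apply/ffunP=> e; apply/eqP; rewrite ffunE (suppN e f0) inE.
by apply/setP=> e; rewrite !inE ffunE eqxx.
Qed.

Lemma card_nonzero_rat : (\sum_(x : Gamma | x != 0%R) 1)%N%:R = #|Gamma|%:R - 1 :> rat.
Proof.
rewrite -sum1_card [in RHS](bigD1 (0 : Gamma)) //= natrD addrC addKr.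
by congr _%:R; apply: eq_bigl => x.
Qed.

(** Induction on [#|A|]: a nonzero value [x] on one edge shifts the target, and the shifted target
    is zero for a single [x], which is itself nonzero only if [t != 0]. The factor [#|Gamma|] avoids
    a division. *)
Lemma card_nowhere_zero_sums A (s : E -> bool) (t : Gamma) :
  #|Gamma|%:R * (\sum_(g | supp g == A)
                   (\sum_(e in A) signed (s e) (g e) == t)%R)%N%:R =
  (#|Gamma|%:R - 1) ^+ #|A| + ((t == 0)%:R * #|Gamma|%:R - 1) * (-1) ^+ #|A| :> rat.
Proof.
move nA: #|A| => n; elim: n A nA t => [|n IHn] A nA t.
  move/cards0_eq: nA => ->; rewrite big_supp0 big_set0 eq_sym !expr0 !mulr1.
  by rewrite mulrC addrC addrNK.
have /card_gt0P[a aA] : (0 < #|A|)%N by rewrite nA.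
have nA' : #|A :\ a| = n by apply/eqP; rewrite -eqSS -nA [in X in _ == X](cardsD1 a) aA.
rewrite -{1}(setD1K aA) big_supp_setU; last first.
  by rewrite disjoints1 !inE eqxx.
rewrite big_supp1 natr_sum mulr_sumr.
(* The induction hypothesis is used with target [t - signed (s a) x], which vanishes exactly when
   [x = signed (s a) t]. *)
rewrite (eq_bigr (fun x => (#|Gamma|%:R - 1) ^+ n +
    ((x == signed (s a) t)%:R * #|Gamma|%:R - 1) * (-1) ^+ n)) => [|x x0].
  rewrite big_split /= -mulr_suml sumrB -mulr_suml.
  have -> : \sum_(x : Gamma | x != 0) 1 = #|Gamma|%:R - 1 :> rat.
    by rewrite -card_nonzero_rat natr_sum.
  have -> : \sum_(x : Gamma | x != 0) (#|Gamma|%:R - 1) ^+ n =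
      (#|Gamma|%:R - 1) * (#|Gamma|%:R - 1) ^+ n :> rat.
    by rewrite -card_nonzero_rat natr_sum mulr_suml; apply: eq_bigr => x _; rewrite mul1r.
  have -> : \sum_(x : Gamma | x != 0) (x == signed (s a) t)%:R = 1 - (t == 0)%:R :> rat.
    rewrite -(signed_eq0 (s a)) -natr_sum; have [->|nz] /= := eqVneq (signed (s a) t) 0.
      by rewrite big1 ?subrr // => x /negbTE->.
    rewrite (bigD1 (signed (s a) t)) //= eqxx big1 ?subr0 // => x /andP[_ /negbTE->] //.
  rewrite !exprS; ring.
have -> : (x == signed (s a) t) = (t - signed (s a) x == 0).
  by rewrite subr_eq0 eq_sym; case: (s a) => //=; rewrite eqr_oppLR.
rewrite -(IHn _ nA'); congr (_ * _%:R); apply: eq_bigr => g /eqP gA.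
have ga : g a = 0 by apply/eqP; rewrite (suppN a gA) !inE eqxx.
rewrite (big_setD1 a aA) /= !ffunE eqxx ga addr0 addrC -[in RHS]subr_eq0 opprB addrA subr_eq0.
rewrite (eq_bigr (fun e => signed (s e) (g e))) // => e.
by rewrite !inE !ffunE => /andP[/negbTE-> _]; rewrite add0r.
Qed.

End Support.

(** * The polynomial factor of a vertex *)

(** This is [((x - 1)^(d-1) - (-1)^(d-1)) / x]: the binomial expansion loses its constant term and
    is divided by [x]. *)
Definition deg_poly (d : nat) : {poly rat} :=
  \sum_(j < d.-1) ((-1) ^+ j * 'C(d.-1, j)%:R) *: 'X^(d - 2 - j).

Lemma deg_poly2 : deg_poly 2 = 1.
Proof. by rewrite /deg_poly big_ord1 bin0 mulr1 scale1r. Qed.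

Lemma deg_polyE d (k : rat) : (1 < d)%N ->
  k * (deg_poly d).[k] = (k - 1) ^+ d.-1 - (-1) ^+ d.-1.
Proof.
case: d => [|[|m]] //= _; rewrite exprDn big_ord_recr /= subnn expr0 binn mulr1n mul1r addrK.
rewrite horner_sum mulr_sumr; apply: eq_bigr => j _.
rewrite hornerZ hornerXn subn2 /= subSn ?(ltnSE (ltn_ord j)) // exprS -mulr_natr; ring.
Qed.

(** * Counting conserved assignments on the tree *)

Section Tree.
Variables (T : mgraph) (T_tree : tree T).

(** The ends of a loop are trivially connected without it, so a loop is no bridge. *)
Lemma tree_loopless (e : edge T) b : ends e b != ends e (~~ b).
Proof.
have := tree_bridge e T_tree; apply: contraNneq => eq_ends.
by case: b eq_ends => /= [->|->]; apply: connect0.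
Qed.

Definition edges_at (v : T) : {set edge T} := [set e | [exists b, ends e b == v]].

(** Without loops each edge at [v] has one half-edge there, and the bit [ends e true == v] selects
    it. *)
Lemma big_half_edges_at (R : Type) (idx : R) (op : Monoid.com_law idx) v
    (F : edge T * bool -> R) :
  \big[op/idx]_(h : edge T * bool | ends h.1 h.2 == v) F h =
  \big[op/idx]_(e in edges_at v) F (e, ends e true == v).
Proof.
rewrite (reindex_onto (fun e => (e, ends e true == v)) fst) /=.
  apply: eq_bigl => e; rewrite eqxx andbT inE; apply/idP/existsP => [ev|[b]].
    by exists (ends e true == v).
  by case: b => /eqP<-; rewrite ?(negbTE (tree_loopless e true)) !eqxx.
move=> [e [|]] /= /eqP ev; rewrite -ev ?eqxx //.
by rewrite (negbTE (tree_loopless e true)).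
Qed.

Lemma card_edges_at v : #|edges_at v| = deg v.
Proof.
rewrite -sum1_card /deg -sum1dep_card.
exact: esym (big_half_edges_at _ v (fun=> 1%N)).
Qed.

Definition adj_in (S : {set T}) : rel T :=
  [rel u v | [&& u \in S, v \in S & adj u v]].

Definition connected_in (S : {set T}) : Prop :=
  forall x y, x \in S -> y \in S ->
    connect (adj_in S) x y.

(** Otherwise a path inside [S] followed by [e2] would join the ends of [e1] while avoiding [e1],
    which cannot lie inside [S] because its end [v] does not; but [e1] is a bridge. *)
Lemma tree_attach_unique (S : {set T}) v (e1 e2 : edge T) b1 b2 :
  connected_in S -> v \notin S -> ends e1 b1 = v -> ends e2 b2 = v ->
  ends e1 (~~ b1) \in S -> ends e2 (~~ b2) \in S -> e1 = e2.
Proof.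
move=> connS vS e1v e2v S1 S2; apply/eqP/negPn/negP => ne12.
have sub : subrel (adj_in S)
    (connect (adj_avoiding e1)).
  move=> u w /and3P[uS wS /existsP[d /existsP[b /andP[du dw]]]].
  apply/connect1/existsP; exists d; apply/existsP; exists b; rewrite du dw !andbT.
  apply: contraNneq vS => de; rewrite -e1v -de.
  by case: (eqVneq b1 b) => [->|]; [rewrite (eqP du)|];
    case: b1 b {e1v S1} du dw => -[] // /eqP du /eqP dw _; rewrite ?du ?dw.
have conn12 := connect_sub sub (connS _ _ S1 S2).
have {}conn12 : connect (adj_avoiding e1) (ends e1 (~~ b1)) (ends e1 b1).
  apply: connect_trans conn12 (connect1 _); apply/existsP; exists e2.
  by apply/existsP; exists (~~ b2); rewrite negbK eqxx e2v e1v eqxx eq_sym ne12.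
have := tree_bridge e1 T_tree; case: b1 {e1v S1} conn12 => /= [->//|].
by rewrite sym_connect_sym ?[X in _ X]/= => [->//|]; apply: adj_avoiding_sym.
Qed.

Lemma connected_in_add (S : {set T}) u v : connected_in S -> u \in S -> adj u v ->
  connected_in (v |: S).
Proof.
move=> connS uS uv.
pose r := adj_in (v |: S); have sub : subrel (adj_in S) (connect r).
  by move=> x y /and3P[xS yS xy]; apply: connect1; rewrite /r /adj_in /= !inE xS yS xy !orbT.
have r_sym : connect_sym r.
  by apply: sym_connect_sym => x y; rewrite /r /adj_in /= adj_sym andbCA.
have from_u x : x \in v |: S -> connect r u x.
  rewrite in_setU1 => /predU1P[->|xS]; last by apply: (connect_sub sub); apply: connS.
  by apply: connect1; rewrite /r /adj_in /= !inE eqxx uS uv orbT.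
by move=> x y xS yS; apply: connect_trans (from_u _ yS); rewrite r_sym from_u.
Qed.

(** The value 1 agrees with [deg_poly] in degree 2, and suits end vertices, where nothing is
    conserved and no new edge appears. *)
Definition vertex_factor (d : nat) : {poly rat} := if (3 <= d)%N then deg_poly d else 1.

Section Count.
Variables (Gamma : finZmodType) (o : edge T -> bool -> bool).
Implicit Types (f g : {ffun edge T -> Gamma}) (B : {set edge T}) (S : {set T}).

(** End vertices are exempt: the circuit replacing one absorbs any inflow. *)
Definition conserves f (v : T) : bool := (deg v == 1%N) || (net o f v == 0).

Lemma net_edges_at (f : edge T -> Gamma) v : net o f v =
  \sum_(e in edges_at v) signed (o e (ends e true == v)) (f e).
Proof. exact: big_half_edges_at. Qed.

(** Only [e1] has a value already, and that value is nonzero; conservation thus prescribes a nonzero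
    signed sum for the remaining edges at [v]. *)
Lemma count_star f B v e1 : supp f = B -> B :&: edges_at v = [set e1] ->
  (\sum_(g | supp g == edges_at v :\ e1) conserves (f + g)%R v)%N%:R
    = (vertex_factor (deg v)).[#|Gamma|%:R] :> rat.
Proof.
move=> fB Bv; have : e1 \in B :&: edges_at v by rewrite Bv inE.
rewrite inE => /andP[e1B e1v].
have card_v : deg v = #|edges_at v :\ e1|.+1 by rewrite -card_edges_at (cardsD1 e1) e1v.
rewrite /conserves /vertex_factor; have [d1|d_ne1] /= := eqVneq (deg v) 1%N.
  (* At an end vertex [e1] is the only edge: no choice is left and no condition is imposed. *)
  have -> : edges_at v :\ e1 = set0 by apply/cards0_eq/eqP; rewrite -eqSS -card_v d1.
  by rewrite d1 big_supp0 /= hornerC.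
have d_gt1 : (1 < deg v)%N by rewrite ltn_neqAle eq_sym d_ne1 card_v.
have -> : (if (2 < deg v)%N then deg_poly (deg v) else 1) = deg_poly (deg v).
  by case: ltnP => // d_le2; rewrite (_ : deg v = 2%N) ?deg_poly2 //;
    apply/eqP; rewrite eqn_leq d_le2.
have k_neq0 : #|Gamma|%:R != 0 :> rat.
  by rewrite Num.Theory.pnatr_eq0 -lt0n; apply/card_gt0P; exists 0.
apply: (mulfI k_neq0); rewrite deg_polyE // card_v /=.
set s := fun e => o e (ends e true == v).
have nz : - signed (s e1) (f e1) != 0 by rewrite oppr_eq0 signed_eq0 (suppN e1 fB) e1B.
transitivity (#|Gamma|%:R * (\sum_(g : {ffun edge T -> Gamma} | supp g == edges_at v :\ e1)
    (\sum_(e in edges_at v :\ e1) signed (s e) (g e) == - signed (s e1) (f e1))%R)%N%:R : rat).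
  congr (_ * _%:R); apply: eq_bigr => g /eqP g_supp; congr (nat_of_bool _).
  have ge1 : g e1 = 0 by apply/eqP; rewrite (suppN e1 g_supp) !inE eqxx.
  rewrite net_edges_at (big_setD1 e1) //= ffunE ge1 addr0 addrC addr_eq0.
  congr (_ == _); apply: eq_bigr => e; rewrite in_setD1 => /andP[e_e1 ev].
  rewrite ffunE (_ : f e = 0) ?add0r //; apply/eqP; rewrite (suppN e fB).
  by apply: contra e_e1 => eB; rewrite -in_set1 -Bv inE eB ev.
by rewrite card_nowhere_zero_sums (negbTE nz) mul0r sub0r mulN1r.
Qed.

Definition flow_count B S : nat :=
  (\sum_(f : {ffun edge T -> Gamma} | supp f == B) [forall u in S, conserves f u])%N.

(** All edges at [S] already lie in [B], so the new values do not disturb conservation on [S]; they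
    only have to satisfy the condition at [v]. *)
Lemma count_add_vertex B S v e1 : (forall u, u \in S -> edges_at u \subset B) ->
  v \notin S -> B :&: edges_at v = [set e1] ->
  (flow_count (B :|: edges_at v) (v |: S))%:R =
    (flow_count B S)%:R * (vertex_factor (deg v)).[#|Gamma|%:R] :> rat.
Proof.
move=> SB vS Bv.
have -> : B :|: edges_at v = B :|: (edges_at v :\ e1).
  apply/setP=> e; rewrite !inE; have /setP/(_ e1) := Bv; rewrite !inE eqxx.
  by case: eqVneq => [->|] //= /andP[->].
rewrite /flow_count big_supp_setU; last first.
  rewrite disjoints_subset; apply/subsetP => e eB; rewrite !inE negb_and negbK.
  by have /setP/(_ e) := Bv; rewrite !inE eB /= => <-; case: [exists _, _].
rewrite !natr_sum mulr_suml; apply: eq_bigr => f /eqP fB.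
rewrite -(count_star fB Bv) -natrM big_distrr /=; congr _%:R.
apply: eq_bigr => g /eqP g_supp; rewrite mulnb; congr (nat_of_bool _).
have fgS u : u \in S -> conserves (f + g) u = conserves f u.
  move=> uS; congr (_ || (_ == _)); rewrite !net_edges_at.
  apply: eq_bigr => e eu; rewrite ffunE (_ : g e = 0) ?addr0 //.
  apply/eqP; rewrite (suppN e g_supp); apply/negP; rewrite in_setD1 => /andP[e_e1 ev].
  move/negP: e_e1; apply; rewrite -in_set1 -Bv inE ev andbT.
  exact: (subsetP (SB u uS)).
apply/forall_inP/andP => [fg|[/forall_inP fS gv] u].
  split; last by apply: fg; rewrite setU11.
  by apply/forall_inP => u uS; rewrite -fgS // fg // setU1r.
by case/setU1P=> [->//|uS]; rewrite fgS // fS.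
Qed.

(** Including [e0] provides a first edge with a value while [S] is still empty. *)
Definition touched (e0 : edge T) S : {set edge T} :=
  e0 |: [set e | [exists b, ends e b \in S]].

(** Induction on [n]. Starting [S] at an end of [e0] makes [e0] one of the edges meeting [S] from
    then on, so that [tree_attach_unique] applies to each later vertex. *)
Lemma count_grow (e0 : edge T) n : (n <= #|T|)%N -> exists S,
  [/\ #|S| = n, connected_in S, (0 < n)%N -> ends e0 true \in S &
      (flow_count (touched e0 S) S)%:R = (#|Gamma|%:R - 1) *
        \prod_(v in S) (vertex_factor (deg v)).[#|Gamma|%:R] :> rat].
Proof.
elim: n => [|n IHn] n_le.
  exists set0; split=> //; first by rewrite cards0.
    by move=> x y; rewrite inE.
  rewrite big_set0 mulr1 /touched (_ : [set e | _] = set0); last first.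
    by apply/setP=> e; rewrite !inE; apply/existsP=> -[b]; rewrite inE.
  rewrite setU0 /flow_count big_supp1 -card_nonzero_rat; congr _%:R.
  apply: eq_bigr => x _; rewrite (_ : [forall _ in _, _]) //.
  by apply/forall_inP => u; rewrite inE.
have [S [cardS connS rS IH]] := IHn (ltnW n_le).
have [v [e1 [vS Bv uv]]] : exists v e1, [/\ v \notin S,
    touched e0 S :&: edges_at v = [set e1] & connected_in (v |: S)
    /\ ends e0 true \in v |: S].
  case: (posnP n) => [n0|n_gt0].
    have S0 : S = set0 by apply/cards0_eq; rewrite cardS.
    exists (ends e0 true), e0; rewrite S0 inE setU0 inE eqxx; split=> //.
      apply/setP=> e; rewrite !inE.
      have -> : [exists b, ends e b \in set0] = false.
        by apply/existsP=> -[b]; rewrite inE.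
      rewrite orbF; case: eqVneq => [->|//]; apply/existsP; by exists true.
    by split=> // x y /set1P-> /set1P->; apply: connect0.
  (* If no edge left [S], connectedness would make [S] the whole vertex set, against [n < #|T|]. *)
  have /existsP[v /existsP[u /and3P[vS uS uv]]] :
      [exists v, exists u, [&& v \notin S, u \in S & adj u v]].
    apply: contraT => /negP no_exit.
    have closedS : closed (@adj T) [pred x | x \in S].
      apply: intro_closed; first exact/sym_connect_sym/adj_sym.
      move=> u v uv uS; apply/negPn/negP => vS; case: no_exit.
      by apply/existsP; exists v; apply/existsP; exists u; rewrite vS uv !andbT.
    move: n_le; rewrite -cardS ltnNge subset_leq_card //; apply/subsetP=> x _.
    have := closed_connect closedS (T_tree.1.2 (ends e0 true) x).
    by rewrite !inE rS.
  have /existsP[e1 /existsP[b /andP[/eqP e1u /eqP e1v]]] := uv.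
  exists v, e1; split=> //.
    have touchedE : touched e0 S = [set e | [exists c, ends e c \in S]].
      apply/setUidPr; rewrite sub1set inE; apply/existsP; exists true; exact: rS.
    apply/setP=> e; rewrite touchedE !inE; apply/andP/eqP => [[/existsP[c cS] /existsP[d /eqP dv]]|->].
      (* The new vertex [v] is outside [S], so an edge at [v] that meets [S] does so at its other
         end. *)
      have cd : c = ~~ d.
        by case: (eqVneq c d) cS => [->|]; [rewrite dv (negbTE vS)|case: c d {dv} => -[]].
      apply: (tree_attach_unique connS vS dv e1v); first by rewrite -cd.
      by rewrite negbK e1u.
    split; apply/existsP; [exists b; by rewrite e1u | by exists (~~ b); rewrite e1v].
  split; first exact: connected_in_add connS uS uv.
  by rewrite setU1r ?rS.
exists (v |: S); split; first by rewrite cardsU1 vS cardS.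
- exact: uv.1.
- by move=> _; exact: uv.2.
have -> : touched e0 (v |: S) = touched e0 S :|: edges_at v.
  rewrite /touched -setUA; congr (_ :|: _); apply/setP=> e; rewrite !inE.
  apply/existsP/orP => [[b]|[/existsP[b eb]|/existsP[b eb]]].
  - by rewrite in_setU1 => /orP[ev|eS]; [right|left]; apply/existsP; exists b.
  - by exists b; rewrite setU1r.
  - by exists b; rewrite in_setU1 eb.
rewrite (count_add_vertex _ vS Bv) ?IH ?big_setU1 //=; first by ring.
move=> u uS; apply/subsetP=> e; rewrite !inE => /existsP[b /eqP eb].
by apply/orP; right; apply/existsP; exists b; rewrite eb.
Qed.

Definition nz_tree_flows : {set {ffun edge T -> Gamma}} :=
  [set f | [forall v, conserves f v] & [forall e, f e != 0]].

Lemma card_nz_tree_flows : (0 < #|edge T|)%N ->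
  #|nz_tree_flows|%:R = (#|Gamma|%:R - 1) *
    \prod_(v : T) (vertex_factor (deg v)).[#|Gamma|%:R] :> rat.
Proof.
case/card_gt0P=> e0 _; have [S [cardS _ _]] := count_grow e0 (leqnn _).
have -> : S = setT by apply/eqP; rewrite eqEcard subsetT cardsT cardS leqnn.
rewrite (eq_bigl xpredT) => [<-|v]; last by rewrite inE.
have -> : touched e0 setT = setT.
  by apply/setP=> e; rewrite !inE; apply/orP; right; apply/existsP; exists true; rewrite inE.
congr _%:R; rewrite /flow_count -sum1dep_card big_mkcond [RHS]big_mkcond.
apply: eq_bigr => f _ /=.
have -> : [forall e, f e != 0] = (supp f == setT).
  apply/forallP/eqP => [f_nz|f_supp e]; last by rewrite (suppN e f_supp) inE.
  by apply/setP=> e; rewrite !inE f_nz.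
have -> : [forall v, conserves f v] = [forall v in setT, conserves f v].
  by apply: eq_forallb => v; rewrite inE.
by case: (supp f == setT); case: [forall v in _, _].
Qed.

End Count.
End Tree.

(** * From the tree to the graph with circuits *)

Lemma net_pair (G : mgraph) (Gamma : zmodType) (o : edge G -> bool -> bool)
    (f : edge G -> Gamma) v :
  net o f v = \sum_e \sum_(b | ends e b == v) signed (o e b) (f e).
Proof. by rewrite pair_big_dep. Qed.

Section Replacement.
Variables (T : mgraph) (sgn : edge T -> bool).
Variables (C : end_vertex T -> sgraph) (a : forall u : end_vertex T, C u).

Lemma repl_at_inner w (v : inner_vertex T) :
  (repl_at a w == inl v) = (w == val v).
Proof.
rewrite /repl_at; destruct (boolP (deg w == 1)) as [w_end|w_inner].
  by apply/esym/negbTE; apply: contraNneq (valP v) => <-.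
by rewrite (inj_eq (@inl_inj _ _)) -val_eqE.
Qed.

Lemma repl_at_end w u (c : C u) :
  (repl_at a w == inr (existT _ u c)) = (w == val u) && (c == a u).
Proof.
rewrite /repl_at; destruct (boolP (deg w == 1)) as [w_end|w_inner].
  have [w_u|w_u] := eqVneq w (val u).
    have -> : exist (fun w => deg w == 1) w w_end = u by apply: val_inj.
    by rewrite (inj_eq (@inr_inj _ _)) eq_Tagged /= eq_sym.
  apply/negbTE; apply: contraNneq w_u.
  by move/(congr1 (fun x => if x is inr p then val (tag p) else w)) => /= ->.
by apply/esym/negbTE; apply: contra w_inner => /andP[/eqP-> _]; exact: (valP u).
Qed.

Section Net.
Variables (Gamma : zmodType) (o : edge (replace_ends sgn a) -> bool -> bool).
Variable f : edge (replace_ends sgn a) -> Gamma.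

(** Generic in [X] so as to restrict orientations as well as flows. *)
Definition tree_part (X : Type) (g : edge (replace_ends sgn a) -> X) (e : edge T) : X :=
  g (inl e).

Definition circuit_part (X : Type) (g : edge (replace_ends sgn a) -> X) u
    (e : edge (C u)) : X :=
  g (inr (existT _ u e)).

Lemma net_inner (v : inner_vertex T) :
  net o f (inl v : replace_ends sgn a) = net (tree_part o) (tree_part f) (val v).
Proof.
rewrite !net_pair big_sumType /= [X in _ + X]big1 ?addr0 => [|[u e] _].
  by apply: eq_bigr => e _; apply: eq_bigl => b; rewrite repl_at_inner.
by rewrite big_pred0.
Qed.

Lemma net_end u (c : C u) :
  net o f (inr (existT _ u c) : replace_ends sgn a) =
    (if c == a u then net (tree_part o) (tree_part f) (val u) else 0) +
    net (circuit_part o (u := u)) (circuit_part f (u := u)) c.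
Proof.
rewrite !net_pair big_sumType /=; congr (_ + _).
  case: ifP => c_a.
    by apply: eq_bigr => e _; apply: eq_bigl => b; rewrite repl_at_end c_a andbT.
  by rewrite big1 // => e _; rewrite big_pred0 // => b; rewrite repl_at_end c_a andbF.
(* The circuit edges are grouped by circuit; only those of [C u] meet a vertex of [C u]. *)
transitivity (\sum_(u' : end_vertex T) \sum_(e : edge (C u'))
  \sum_(b | existT (fun u => vert (C u)) u' (ends e b) == existT _ u c)
    signed (o (inr (existT _ u' e)) b) (f (inr (existT _ u' e)))).
  rewrite [RHS]sig_big_dep /=; apply: eq_bigr => -[u' e] _.
  by apply: eq_bigl => b; rewrite (inj_eq (@inr_inj _ _)).
rewrite (bigD1 u) //= [X in _ + X]big1 ?addr0 => [|u' ne_u].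
  by apply: eq_bigr => e _; apply: eq_bigl => b; rewrite eq_Tagged.
rewrite big1 // => e _; rewrite big_pred0 // => b; apply/negbTE.
by apply: contraNneq ne_u => /(congr1 tag) /= ->.
Qed.
End Net.

Hypothesis T_tree : tree T.
Hypothesis C_unbalanced : forall u : end_vertex T, unbalanced_circuit (C u).
Variables (o : edge (replace_ends sgn a) -> bool -> bool) (o_orient : orientation o).
Variables (Gamma : finZmodType) (odd_Gamma : odd #|Gamma|).

Lemma circuit_part_orientation u : orientation (circuit_part o (u := u)).
Proof. by move=> e; exact: (o_orient (inr (existT _ u e))). Qed.

Lemma net_end_neq0 (f : edge T -> Gamma) (u : end_vertex T) :
  (forall e, f e != 0) -> net (tree_part o) f (val u) != 0.
Proof.
move=> f_nz; rewrite (net_edges_at T_tree).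
have /cards1P[e ->] : #|edges_at (val u)| == 1%N.
  by rewrite (card_edges_at T_tree); exact: valP u.
by rewrite big_set1 signed_eq0.
Qed.

(** Restriction to the tree edges is a bijection: the values on the tree determine all nets required
    on the circuits, and each circuit realizes them in exactly one way. *)
Lemma card_nz_flows_replace_ends :
  #|nz_flows o Gamma| = #|nz_tree_flows Gamma (tree_part o)|.
Proof.
pose rho (f : {ffun edge (replace_ends sgn a) -> Gamma}) : {ffun edge T -> Gamma} :=
  finfun (tree_part f).
have net_rho f v : net (tree_part o) (rho f) v = net (tree_part o) (tree_part f) v.
  by apply: eq_net => h _; rewrite ffunE.
have unb_inj u := unbalanced_net_inj (C_unbalanced u).1 odd_Gamma
  (@circuit_part_orientation u) (C_unbalanced u).2.
have rho_inj : {in nz_flows o Gamma &, injective rho}.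
  move=> f g; rewrite !inE !is_flowE => /andP[/forallP f0 _] /andP[/forallP g0 _] fg.
  have fgT : tree_part f =1 tree_part g.
    by move=> e; have /ffunP/(_ e) := fg; rewrite !ffunE.
  apply/ffunP=> -[e|[u e]]; first exact: fgT.
  apply: (unb_inj u (circuit_part f (u := u)) (circuit_part g (u := u))) => c.
  have := eqP (f0 (inr (existT _ u c))); rewrite -(eqP (g0 (inr (existT _ u c)))) !net_end.
  by rewrite -!net_rho fg => /addrI.
rewrite -(card_in_imset rho_inj); apply: eq_card => fT; apply/imsetP/idP.
  case=> f; rewrite !inE is_flowE => /andP[/forallP f0 /forallP f_nz] ->.
  apply/andP; split; apply/forallP; last by move=> e; rewrite ffunE f_nz.
  move=> v.
  rewrite /conserves; case: (boolP (deg v == 1%N)) => //= v_inner.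
  by rewrite net_rho; have := f0 (inl (exist _ v v_inner)); rewrite net_inner.
rewrite inE => /andP[/forallP fT_cons /forallP fT_nz].
(* On each circuit, [h] is chosen to cancel what the tree edge brings in at [a u]. *)
have /fin_all_exists[h hP] u : exists h : {ffun edge (C u) -> Gamma}, forall c,
    net (circuit_part o (u := u)) h c =
      - (if c == a u then net (tree_part o) fT (val u) else 0).
  exact: (unbalanced_net_onto (C_unbalanced u).1 odd_Gamma
    (@circuit_part_orientation u) (C_unbalanced u).2).
pose f : {ffun edge (replace_ends sgn a) -> Gamma} :=
  [ffun e => match e with inl e => fT e | inr p => h (tag p) (tagged p) end].
have fT_f : rho f = fT by apply/ffunP=> e; rewrite !ffunE /tree_part ffunE.
have h_f u : circuit_part f (u := u) =1 h u by move=> e; rewrite /circuit_part ffunE.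
exists f; last by [].
rewrite inE is_flowE; apply/andP; split; apply/forallP; [case=> [v|[u c]] | case=> [e|[u e]]].
- rewrite net_inner -net_rho fT_f; have := fT_cons (val v).
  by rewrite /conserves (negbTE (valP v)).
- rewrite net_end -net_rho fT_f (@eq_net _ _ _ _ (h u)) => [|e _]; last exact: h_f.
  by rewrite hP subrr.
- by rewrite ffunE.
rewrite -[f _]/(circuit_part f e) h_f.
apply: (unbalanced_nowhere_zero (C_unbalanced u).1 (o := circuit_part o (u := u)) (a := a u)).
  by move=> c /negbTE c_a; rewrite hP c_a oppr0.
by rewrite hP eqxx oppr_eq0 net_end_neq0.
Qed.

End Replacement.

(** * Identification of the polynomial *)

Lemma poly_eq_on_odd (p q : {poly rat}) :
  (forall k : nat, odd k -> (1 < k)%N -> p.[k%:R] = q.[k%:R]) -> p = q.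
Proof.
move=> pq; apply/eqP; rewrite -subr_eq0; apply/eqP.
(* The odd numbers 3, 5, 7, ... are roots of [p - q]; taking [size (p - q)] of them exceeds the
   degree. *)
pose rs : seq rat := [seq (i.*2.+3)%:R | i <- iota 0 (size (p - q))].
apply: (@roots_geq_poly_eq0 _ _ rs); last by rewrite size_map size_iota.
  by apply/allP=> _ /mapP[i _ ->]; rewrite /root hornerD hornerN pq ?subrr //= negbK odd_double.
rewrite map_inj_uniq ?iota_uniq // => i j /eqP.
by rewrite Num.Theory.eqr_nat !eqSS => /eqP/double_inj.
Qed.

Theorem mainTheorem7 (T : mgraph) (sgn : edge T -> bool)
    (C : end_vertex T -> sgraph) (a : forall u : end_vertex T, C u)
    (T_tree : tree T) (T_edge : (0 < #|edge T|)%N)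
    (C_unbalanced : forall u : end_vertex T, unbalanced_circuit (C u))
    (p : {poly rat}) :
  is_F0 (replace_ends sgn a) p <->
  p = ('X - 1) *
      \prod_(v : T | (3 <= deg v)%N)
        \sum_(j < (deg v).-1)
          ((-1) ^+ j * 'C((deg v).-1, j)%:R) *: 'X^(deg v - 2 - j).
Proof.
set q := (X in _ <-> p = X).
have qE : q = ('X - 1) * \prod_(v : T) vertex_factor (deg v).
  by rewrite /q big_mkcond.
have q_flows o : orientation o -> forall Gamma : finZmodType, odd #|Gamma| ->
    q.[#|Gamma|%:R] = #|nz_flows (G := replace_ends sgn a) o Gamma|%:R.
  move=> o_orient Gamma odd_Gamma.
  rewrite (card_nz_flows_replace_ends T_tree C_unbalanced o_orient odd_Gamma).
  by rewrite (card_nz_tree_flows T_tree) // qE hornerM horner_prod !hornerE.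
split=> [pF0|->]; last exact: q_flows.
apply: poly_eq_on_odd => k odd_k k_gt1.
(* Some orientation is needed to compare the counts: here negative edges are extroverted and
   positive ones point to their [true] end. *)
pose o (e : edge (replace_ends sgn a)) b := (negative e || b).
have o_orient : orientation o by move=> e; rewrite /o orbF orbT; case: negative.
have card_k : #|'Z_k| = k by rewrite card_ord Zp_cast.
have := pF0 o o_orient 'Z_k; have := q_flows o o_orient 'Z_k.
by rewrite card_k => -> // ->.
Qed.
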